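(* There is no regular graph of odd degree $d\ge3$, girth $5$ and cyclic excess.
   Context: For an integer $d\ge 1$ define polynomials $G_{d,m}(x)$ by $G_{d,0}(x)=1$, $G_{d,1}(x)=x+1$, and $G_{d,m+1}(x)=xG_{d,m}(x)-(d-1)G_{d,m-1}(x)$ for $m\ge1$. Let $J_n$ be the $n\times n$ all-ones matrix. For a graph on $n\ge3$ vertices, a cycle matrix is the adjacency matrix $B$ of an $n$-cycle on the same vertex set (i.e., for some ordering $v_1,\dots,v_n$ of the vertices, $B_{ij}=1$ iff $v_i,v_j$ are cyclically consecutive, and $0$ otherwise); this cycle need not consist of edges of the graph. A graph $\Gamma$ of order $n$ with adjacency matrix $A$ is a graph of degree $d$, girth $g$ and cyclic excess if $\Gamma$ is $d$-regular with $d\ge3$, has odd girth $g\ge5$, and $G_{d,\lfloor g/2\rfloor}(A)=J_n-B$ for some cycle matrix $B$. (For $g=5$ this reads $A^2+A-(d-1)I_n=J_n-B$.) *)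

(* Defs.v *)
From mathcomp Require Import all_boot all_order all_fingroup all_algebra.

Set Implicit Arguments.
Unset Strict Implicit.
Unset Printing Implicit Defensive.

Import GRing.Theory.
Local Open Scope ring_scope.

Fixpoint G (d m : nat) : {poly int} :=
  match m with
  | 0 => 1
  | 1 => 'X + 1
  | (m'.+1 as m1).+1 => 'X * G d m1 - (d%:R - 1)%:P * G d m'
  end.

Definition simple_graph (T : finType) (e : rel T) : Prop :=
  symmetric e /\ irreflexive e.

Definition regular (T : finType) (e : rel T) (d : nat) : Prop :=
  forall x : T, #|[set y | e x y]| = d.

(* [ucycle] alone also accepts sequences of length at most 2, such as an edge
   traversed back and forth; these are not cycles of a simple graph. *)
Definition graph_cycle (T : finType) (e : rel T) (c : seq T) : Prop :=
  (3 <= size c)%N /\ ucycle e c.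

Definition has_girth (T : finType) (e : rel T) (g : nat) : Prop :=
  (exists c : seq T, graph_cycle e c /\ size c = g) /\
  (forall c : seq T, graph_cycle e c -> (g <= size c)%N).

Definition adjmx (n : nat) (e : rel 'I_n) : 'M[int]_n :=
  \matrix_(i, j) (e i j)%:R.

(* The permutation [v] is the ordering of the vertices; [ordS] is the cyclic
   successor on ['I_n]. *)
Definition cycle_mx (n : nat) (B : 'M[int]_n) : Prop :=
  (3 <= n)%N /\
  exists v : {perm 'I_n}, forall i j : 'I_n,
    B (v i) (v j) = ((ordS i == j) || (ordS j == i))%:R.

(* The vertex set is ['I_n.+1], so the order is [n.+1]: [horner_mx] is defined
   on nonempty square matrices only. *)
Definition cyclic_excess_graph (n : nat) (e : rel 'I_n.+1) (d g : nat) : Prop :=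
  [/\ simple_graph e,
      (3 <= d)%N /\ regular e d,
      [/\ odd g, (5 <= g)%N & has_girth e g] &
      exists B : 'M[int]_n.+1,
        cycle_mx B /\ horner_mx (adjmx e) (G d g./2) = const_mx 1 - B].

(* Main.v *)
Require Import Defs.
From mathcomp Require Import all_boot all_order all_fingroup all_algebra.
From mathcomp Require Import ring.

(** Since [B] is [J] minus a polynomial in [A], it commutes with [A].  Labelling
    the vertices by [Z/n] along the cycle, commutation reads
    [e(x+1,y) + e(x-1,y) = e(x,y+1) + e(x,y-1)], a discrete wave equation.
    Hence [e(x+1,y+1) - e(x,y)] depends only on [x+y] and
    [e(x+1,y-1) - e(x,y)] only on [x-y].  As [e] vanishes on the diagonal and
    is 0/1-valued, [e(x,y)] depends only on [x-y] when [x-y] is a double, and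
    on the remaining pairs it depends either only on [x-y] or only on [x+y].
    In the first case the graph is circulant and has a 4-cycle.  In the second
    an edge of each kind spans a 4-cycle, so only edges with [x-y] not a double
    remain, and the graph is bipartite, contradicting girth 5. *)

Set Implicit Arguments.
Unset Strict Implicit.
Unset Printing Implicit Defensive.

Import GRing.Theory.
Local Open Scope ring_scope.

(** * From the matrix equation to the wave equation *)

Lemma adjmx_const_comm (n d : nat) (e : rel 'I_n) :
  symmetric e -> regular e d ->
  adjmx e *m const_mx 1 = const_mx 1 *m adjmx e :> 'M[int]_n.
Proof.
move=> es er; apply/matrixP=> i j; rewrite !mxE.
have deg x : \sum_k (e x k)%:R = d%:R :> int.
  by rewrite -natr_sum -(er x) -sum1_card [in RHS]big_mkcond /=;
     congr (_%:R); apply: eq_bigr => k _; rewrite inE; case: (e x k).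
transitivity (d%:R : int).
  by rewrite -(deg i); apply: eq_bigr => k _; rewrite !mxE mulr1.
by rewrite -(deg j); apply: eq_bigr => k _; rewrite !mxE mul1r es.
Qed.

Lemma excess_mx_comm (n d m : nat) (e : rel 'I_n.+1) (B : 'M[int]_n.+1) :
  symmetric e -> regular e d ->
  horner_mx (adjmx e) (G d m) = const_mx 1 - B ->
  adjmx e *m B = B *m adjmx e.
Proof.
move=> es er eqB.
have -> : B = const_mx 1 - horner_mx (adjmx e) (G d m) by rewrite eqB subKr.
by rewrite mulmxBr mulmxBl (adjmx_const_comm es er) comm_mx_horner.
Qed.

(** At order at least 3 the neighbours [j - 1] and [j + 1] differ, so each gives its own term. *)
Lemma sum_cycle_neighbours (m : nat) (F : 'I_m.+3 -> int) (j : 'I_m.+3) :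
  \sum_k F k * ((ordS k == j) || (ordS j == k))%:R = F (j - 1) + F (j + 1).
Proof.
have ordSE (x : 'I_m.+3) : ordS x = x + 1 by apply: val_inj; rewrite /= addn1.
have neq : j + 1 != j - 1.
  by rewrite -subr_eq0 opprB addrC addrA subrK.
rewrite (bigD1 (j - 1)) //= (bigD1 (j + 1)) //= big1 => [|k /andP[k1 k2]].
  by rewrite !ordSE subrK !eqxx orbT !mulr1 addr0.
by rewrite !ordSE eq_sym -subr_eq eq_sym (negPf k1) eq_sym (negPf k2) mulr0.
Qed.

Definition wave (R : finComNzRingType) (f : rel R) : Prop := forall x y : R,
  (f (x + 1)%R y + f (x - 1)%R y = f x (y + 1)%R + f x (y - 1)%R)%N.

Lemma cycle_comm_wave (m : nat) (e : rel 'I_m.+3) (v : {perm 'I_m.+3})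
  (B : 'M[int]_m.+3) :
  (forall i j, B (v i) (v j) = ((ordS i == j) || (ordS j == i))%:R) ->
  adjmx e *m B = B *m adjmx e ->
  wave (fun x y : 'I_m.+3 => e (v x) (v y)).
Proof.
move=> Bv /matrixP AB x y; move: (AB (v x) (v y)); rewrite !mxE.
rewrite (reindex_inj (@perm_inj _ v)) [RHS](reindex_inj (@perm_inj _ v)) /=.
under eq_bigr do rewrite Bv mxE.
rewrite (sum_cycle_neighbours (fun k => (e (v x) (v k))%:R)).
under eq_bigr do rewrite Bv mxE mulrC orbC.
by rewrite (sum_cycle_neighbours (fun k => (e (v k) (v y))%:R)) /= !natz => -[sumE];
  rewrite addnC -sumE addnC.
Qed.

(** * Boolean solutions of the wave equation on Z/n, viewed as a ring additively generated by 1 *)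

Section Wave.

Variables (R : finComNzRingType) (f : rel R).
Hypothesis R_cyclic : forall x : R, exists k : nat, x = k%:R.
Hypotheses (f_sym : symmetric f) (f_irr : irreflexive f) (f_wave : wave f).

(** In Z/n these are the even classes for even n and all elements for odd n, so one parity argument
    serves both. *)
Definition double (x : R) : bool := [exists a, x == a + a].

Lemma doubleP x : reflect (exists a, x = a + a) (double x).
Proof. exact: 'exists_eqP. Qed.

Lemma doubleD x y : double x -> double y -> double (x + y).
Proof.
by move=> /doubleP[a ->] /doubleP[b ->]; apply/doubleP; exists (a + b); ring.
Qed.

Lemma doubleN x : double (- x) = double x.
Proof.
suff h z : double z -> double (- z).
  by apply/idP/idP => /h; rewrite ?opprK.
by move=> /doubleP[a ->]; apply/doubleP; exists (- a); ring.
Qed.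

Lemma doubleDdbl x y : double (x + (y + y)) = double x.
Proof.
have dyy : double (y + y) by apply/doubleP; exists y.
apply/idP/idP => [d|/doubleD->//].
by rewrite -(addrK (y + y) x) doubleD ?doubleN.
Qed.

Lemma double_or_succ x : double x || double (x + 1).
Proof.
have [k ->] := R_cyclic x; apply/orP.
rewrite -(odd_double_half k) -addnn; case: (odd k); last first.
  by left; apply/doubleP; exists k./2%:R; rewrite add0n natrD.
by right; apply/doubleP; exists (1 + k./2%:R); rewrite !natrD mulr1n; ring.
Qed.

(** The doubles form a subgroup of index at most 2. *)
Lemma doubleD_not x y : ~~ double x -> ~~ double y -> double (x + y).
Proof.
move: (double_or_succ x) (double_or_succ y).
case: (double x) => //= /doubleP[a xa]; case: (double y) => //= /doubleP[b yb].
move=> _ _; apply/doubleP; exists (a + b - 1).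
by rewrite -[x](addrK 1) -[y](addrK 1) xa yb; ring.
Qed.

Lemma shift_invariant (T : Type) (F : R -> T) :
  (forall x, F (x + 1) = F x) -> forall x y, F x = F y.
Proof.
move=> Fs; suff F0 x : F x = F 0 by move=> x y; rewrite !F0.
have [k ->] := R_cyclic x; elim: k => [|k <-]; first by rewrite mulr0n.
by rewrite -addn1 natrD Fs.
Qed.

Definition diag_step x y : int := (f (x + 1) (y + 1))%:Z - (f x y)%:Z.
Definition anti_step x y : int := (f (x + 1) (y - 1))%:Z - (f x y)%:Z.

(** The wave equation centred at [(t + 1, x + y - t)] equates the steps at [(t, x + y - t)] and
    [(t + 1, x + y - t - 1)]. *)
Lemma diag_step_sum x y x' y' : x + y = x' + y' ->
  diag_step x y = diag_step x' y'.
Proof.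
move=> eq_sum; have -> : y' = x + y - x' by rewrite eq_sum; ring.
rewrite -[y in LHS](addrK x) [y + x]addrC.
apply: (shift_invariant (F := fun t => diag_step t (x + y - t))) => t.
rewrite /diag_step; have := f_wave (t + 1) (x + y - t).
rewrite addrK; have -> : x + y - (t + 1) = x + y - t - 1 by ring.
by rewrite subrK; do 4!case: (f _ _).
Qed.

Lemma anti_step_diff x y x' y' : x - y = x' - y' ->
  anti_step x y = anti_step x' y'.
Proof.
move=> eq_diff; have -> : y' = x' - (x - y) by rewrite eq_diff; ring.
rewrite -[y in LHS](subKr x).
apply: (shift_invariant (F := fun t => anti_step t (t - (x - y)))) => t.
rewrite /anti_step; have := f_wave (t + 1) (t - (x - y)).
rewrite addrK; have -> : t + 1 - (x - y) = t - (x - y) + 1 by ring.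
by rewrite addrK; do 4!case: (f _ _).
Qed.

(** If [x - y = a + a], the antidiagonal of [(x, y)] meets the main diagonal at [(y + a, y + a)],
    where the step vanishes by irreflexivity. *)
Lemma double_diff_shift x y t : double (x - y) -> f (x + t) (y + t) = f x y.
Proof.
move=> /doubleP[a xya].
rewrite -[in RHS](addr0 x) -[in RHS](addr0 y).
apply: (shift_invariant (F := fun t => f (x + t) (y + t))) => s.
rewrite !addrA.
suff: diag_step (x + s) (y + s) = 0 by rewrite /diag_step; do 2!case: (f _ _).
rewrite (@diag_step_sum _ _ (y + a + s) (y + a + s)).
  by rewrite /diag_step !f_irr.
by rewrite -[x](subrK y) xya; ring.
Qed.

(* A nonzero diagonal step at [(x0, y0)] forces the 0/1 values to be constant
   on the whole antidiagonal of [(x0, y0)], hence kills the antidiagonal steps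
   on all diagonals which it meets. *)
Lemma wave_dichotomy :
  (forall x y t, f (x + t) (y + t) = f x y) \/
  (forall x y t, ~~ double (x - y) -> f (x + t) (y - t) = f x y).
Proof.
have [/existsP[x0 /existsP[y0 ne]]|/existsPn all0] :=
  boolP [exists x, exists y, diag_step x y != 0].
  right=> x y t nxy; rewrite -[in RHS](addr0 x) -[in RHS](subr0 y).
  apply: (shift_invariant (F := fun t => f (x + t) (y - t))) => s.
  have nxy0 : ~~ double (x0 + y0).
    apply: contra ne => dxy; apply/eqP; rewrite /diag_step double_diff_shift ?subrr //.
    by rewrite -(doubleDdbl _ y0) (_ : _ + _ = x0 + y0) //; ring.
  have nxys : ~~ double ((x + s) - (y - s)).
    by rewrite (_ : _ - _ = x - y + (s + s)) ?doubleDdbl //; ring.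
  (* The antidiagonal of [(x0, y0)] meets the diagonal of [(x + s, y - s)] at [(a, x0 + y0 - a)]. *)
  have /doubleP[a eqa] := doubleD_not nxys nxy0.
  have eqd : (x + s) - (y - s) = a - (x0 + y0 - a).
    by rewrite -[LHS](addrK (x0 + y0)) eqa; ring.
  have := anti_step_diff eqd; rewrite /anti_step -addrA -[y - s - 1]addrA -opprD.
  (* The diagonal steps at this point and at the next one on the antidiagonal are the same nonzero
     number, whose sign determines [f] at both points. *)
  have := @diag_step_sum a (x0 + y0 - a) x0 y0 (subrKC _ _).
  have := @diag_step_sum (a + 1) (x0 + y0 - a - 1) x0 y0.
  move=> /(_ ltac:(ring)); move: ne; rewrite /diag_step.
  by do 8!case: (f _ _).
left=> x y t; rewrite -[in RHS](addr0 x) -[in RHS](addr0 y).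
apply: (shift_invariant (F := fun t => f (x + t) (y + t))) => s.
rewrite !addrA; have /existsPn/(_ (y + s)) := all0 (x + s).
by rewrite negbK /diag_step => /eqP; do 2!case: (f _ _).
Qed.

(** * Short cycles in the relabelled graph *)

Lemma ex_C4 a b c d : f a b -> f b c -> f c d -> f d a -> a != c -> b != d ->
  exists c4, size c4 = 4 /\ ucycle f c4.
Proof.
have nf y z : f y z -> y != z by apply: contraTneq => ->; rewrite f_irr.
move=> fab fbc fcd fda ac bd; exists [:: a; b; c; d]; split=> //.
apply/andP; split; first by rewrite /= fab fbc fcd fda.
rewrite /= !inE !negb_or ac bd (nf _ _ fab) (nf _ _ fbc) (nf _ _ fcd).
by rewrite eq_sym (nf _ _ fda).
Qed.

Lemma circulant_C4 : (forall x y t, f (x + t) (y + t) = f x y) ->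
  (2 < #|[set y | f 0%R y]|)%N ->
  exists c, size c = 4 /\ ucycle f c.
Proof.
move=> circ /card_gt2P[a [b [c [[]]]]]; rewrite !inE => fa fb fc [ab bc ca].
(* At most one of [b] and [c] is [- a]; the other one makes [0] and [a + b] distinct. *)
wlog nab : b c fb fc ab bc ca / b != - a => [wl|].
  have [ba|] := eqVneq b (- a); last exact: (wl b c).
  by apply: (wl c b); rewrite // -?ba eq_sym.
have f0 x y : f x y = f 0 (y - x) by rewrite -(circ 0 (y - x) x) add0r subrK.
apply: (@ex_C4 0 a (a + b) b) => //.
- by rewrite f0 addrAC subrr add0r.
- by rewrite f_sym f0 addrK.
- by rewrite f_sym.
- by rewrite eq_sym addrC addr_eq0.
Qed.

(** Edges of double difference [s] translate to every [z], joining [z] to [z + s]; the edge [p q]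
    slides along its antidiagonal to [p + s], [q - s]. These close the cycle
    [p, q, q - s, p + s]. *)
Lemma mixed_C4 x s p q :
  (forall x y t, ~~ double (x - y) -> f (x + t) (y - t) = f x y) ->
  f x (x + s) -> double s -> f p q -> ~~ double (p - q) ->
  exists c, size c = 4 /\ ucycle f c.
Proof.
move=> hank fxs ds fpq npq.
have fs z : f z (z + s).
  rewrite -(subrKC x z) -[_ + s]addrAC double_diff_shift //.
  by rewrite opprD addNKr doubleN.
apply: (@ex_C4 p q (q - s) (p + s)) => //.
- by rewrite f_sym -[q in f _ q](subrK s).
- by rewrite f_sym hank.
- by rewrite f_sym.
- by apply: contraNneq npq => ->; rewrite addrAC subrr add0r doubleN.
by apply: contraNneq npq => ->; rewrite opprD addNKr doubleN.
Qed.

(** Four successive non-double differences add up to a double, so the fifth edge cannot close the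
    cycle. *)
Lemma bipartite_no_C5 c : (forall x y, f x y -> ~~ double (x - y)) ->
  size c = 5 -> ~ path.cycle f c.
Proof.
move=> bip; case: c => [|x0 [|x1 [|x2 [|x3 [|x4 []]]]]] //= _.
move=> /and5P[/bip n01 /bip n12 /bip n23 /bip n34 /andP[/bip n40 _]].
case/negP: n40; rewrite -doubleN opprB.
have := doubleD (doubleD_not n01 n12) (doubleD_not n23 n34).
by congr double; ring.
Qed.

Lemma wave_girth5 c : (2 < #|[set y | f 0%R y]|)%N ->
  (forall c, ucycle f c -> size c != 4) -> size c = 5 -> ~ path.cycle f c.
Proof.
move=> deg noC4; case: wave_dichotomy => [circ|hank].
  by have [c4 [s4 /noC4]] := circulant_C4 circ deg; rewrite s4.
have [/existsP[x /existsP[y /andP[fxy dxy]]]|/existsPn noeven] :=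
  boolP [exists x, exists y, f x y && double (x - y)]; last first.
  apply: bipartite_no_C5 => x y fxy.
  by have /existsPn/(_ y) := noeven x; rewrite fxy.
have [/existsP[p /existsP[q /andP[fpq npq]]]|/existsPn noodd] :=
  boolP [exists x, exists y, f x y && ~~ double (x - y)].
  have [||c4 [s4 /noC4]] := @mixed_C4 x (y - x) p q hank _ _ fpq npq.
  - by rewrite subrKC.
  - by rewrite -doubleN opprB.
  by rewrite s4.
(* If every edge has double difference, [f] vanishes on the other diagonals, so the graph is again
   circulant. *)
have edge_double x1 y1 : f x1 y1 -> double (x1 - y1).
  by move=> fxy1; have /existsPn/(_ y1) := noodd x1; rewrite fxy1 negbK.
have [|c4 [s4 /noC4]] := circulant_C4 _ deg; last by rewrite s4.
move=> x1 y1 t; have [/double_diff_shift->//|nd] := boolP (double (x1 - y1)).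
apply/idP/idP => /edge_double; last by rewrite (negPf nd).
by rewrite opprD addrACA subrr addr0 (negPf nd).
Qed.

End Wave.

Local Close Scope ring_scope.

Theorem theorem4 (d : nat) (hd3 : 3 <= d) (hodd : odd d) :
  ~ exists (n : nat) (e : rel 'I_n.+1), cyclic_excess_graph e d 5.
Proof.
move=> [n [e [[es ei] [_ er] [_ _ [[c [[_ /andP[cc _]] sc]] girth]]]]].
move=> [B [[n3 [v Bv]] eqB]].
case: n => [|[|m]] // in e es ei er c cc sc girth B n3 v Bv eqB *.
have ew := cycle_comm_wave Bv (excess_mx_comm es er eqB).
have cyc (x : 'I_m.+3) : exists k : nat, x = k%:R%R by exists x; rewrite natr_Zp.
pose f : rel 'I_m.+3 := fun x y => e (v x) (v y).
have ecycle c' : path.cycle f c' = path.cycle e (map v c') by rewrite cycle_map.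
have [fs fi] : symmetric f /\ irreflexive f by split=> [x y|x]; [apply: es|apply: ei].
(* The 5-cycle is pulled back along [v]; a 4-cycle of [f] would be carried by [v] to one of [e],
   against girth 5. *)
apply: (wave_girth5 cyc fs fi ew (c := map (perm_inv v) c)).
- rewrite -(card_imset _ (@perm_inj _ v)).
  suff -> : v @: [set y | f 0%R y] = [set y | e (v 0%R) y] by rewrite er.
  apply/setP=> y; rewrite inE; apply/imsetP/idP => [[z]|evy].
    by rewrite inE => ? ->.
  by exists ((v^-1)%g y); rewrite ?inE /f permKV.
- move=> c' /andP[cc' uc']; apply/eqP=> s4.
  suff /girth : graph_cycle e (map v c') by rewrite size_map s4.
  split; first by rewrite size_map s4.
  by rewrite /ucycle -ecycle cc' (map_inj_uniq (@perm_inj _ v)).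
- by rewrite size_map.
by rewrite ecycle -map_comp (eq_map (permKV v)) map_id.
Qed.
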